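(* Consider $SE = \{\mathtt{O}=s(\mathtt{X},\mathtt{A}),\ \mathtt{X}=X,\ \mathtt{A}=A\}$. For all conditions $\varphi$, one of the following is true: (1) $\varphi$ is closed for $SE$; (2) $s$ is uninformative; (3) $s$ can trivially close $\varphi$ given $SE$; or (4) for all $o$, $\varphi$ is open for $\{\mathtt{O}\neq o \lor \varphi,\ SE\}$ but closed for $\{\mathtt{O}=o,\ \mathtt{O}\neq o \lor \varphi,\ SE\}$.
   Context: All probabilities are discrete (they may be read as frequentist or as Bayesian). $X$ and $A$ are background random variables and $s$ is a function (the system). The structural equations $SE$ define $\mathtt{X}=X$, $\mathtt{A}=A$, and the output $\mathtt{O}=s(\mathtt{X},\mathtt{A})$. $\Pr[\cdot\mid SE]$ is the probability with the variables so defined, and a condition $\varphi$ is an event. The letter $o$ ranges over the set of outputs of $s$. For conditions $\psi_1,\dots,\psi_n$, write $\{\psi_1,\dots,\psi_n,SE\}$ for the background information consisting of $SE$ together with all the $\psi_j$; probabilities given it are obtained by conditioning additionally on all the $\psi_j$. Background information is consistent iff its conditions jointly have positive probability. For background information $C$: $\varphi$ is closed for $C$ iff $C$ is consistent and $\Pr[\varphi\mid C]$ is $0$ or $1$; $\varphi$ is open for $C$ iff $C$ is consistent and $0<\Pr[\varphi\mid C]<1$. The system $s$ is uninformative iff there exists an output $o$ such that $\Pr[\mathtt{O}=o\mid SE]=1$. The system $s$ can trivially close $\varphi$ given $SE$ iff, for some $o$, $\varphi$ is open for $SE$ but closed for $\{\mathtt{O}=o,\ SE\}$.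
   Formalization: The outputs o are restricted to values of s on inputs that (X, A) takes with positive probability; for an output of probability zero, {O=o, O≠o ∨ φ, SE} is inconsistent, so alternative (4) and the claim itself could fail. *)

(* Defs.v *)
From mathcomp Require Import all_boot all_order all_algebra.
From mathcomp Require Import boolp classical_sets cardinality reals ereal.
From mathcomp Require Import measure probability.
Set Implicit Arguments.
Unset Strict Implicit.
Unset Printing Implicit Defensive.
Import Order.TTheory GRing.Theory Num.Theory.
Local Open Scope classical_set_scope.
Local Open Scope ring_scope.

(* Every set of outcomes is an event and the mass sits on countably many
   outcomes, so that arbitrary functions on W are discrete random variables.
   Outcomes of probability zero are allowed. *)
Definition discrete d (W : measurableType d) (R : realType)
    (P : probability W R) : Prop :=
  (forall B : set W, measurable B) /\
  (exists2 S : set W, countable S & P S = 1%E).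

Section StructuralEquations.
Variables (W XT AT OT : Type).

(* Values of the defined variables X, A, O, next to the background outcome. *)
Record valuation := Valuation {
  outcome : W;
  valX : XT;
  valA : AT;
  valO : OT }.

Definition condition := set valuation.

Definition out_is (o : OT) : condition := [set v | valO v = o].
Definition out_isnt (o : OT) : condition := [set v | valO v <> o].

Record struct_eqs := StructEqs {
  bgX : W -> XT;
  bgA : W -> AT;
  sys : XT -> AT -> OT }.

(* The unique solution of  X = bgX, A = bgA, O = sys X A  at an outcome. *)
Definition solution (SE : struct_eqs) (w : W) : valuation :=
  let x := bgX SE w in
  let a := bgA SE w in
  Valuation w x a (sys SE x a).

End StructuralEquations.

Section Closing.
Context d (W : measurableType d) (R : realType) (P : probability W R).
Variables (XT AT OT : Type) (SE : struct_eqs W XT AT OT).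
Implicit Types (phi : condition W XT AT OT) (C : seq (condition W XT AT OT)).

Definition PrSE phi : R := fine (P (solution SE @^-1` phi)).

(* A sequence [:: psi_1; ...; psi_n] stands for the background information
   {psi_1, ..., psi_n, SE}; in particular [::] stands for SE alone. *)
Definition all_conds C : condition W XT AT OT := \big[setI/setT]_(psi <- C) psi.

Definition consistent C : Prop := 0 < PrSE (all_conds C).

Definition Pr_given phi C : R :=
  PrSE (phi `&` all_conds C) / PrSE (all_conds C).

Definition closed_for phi C : Prop :=
  consistent C /\ (Pr_given phi C = 0 \/ Pr_given phi C = 1).

Definition open_for phi C : Prop :=
  consistent C /\ 0 < Pr_given phi C < 1.

(* The outputs of the system: its values on the inputs that (X, A) can take,
   i.e. takes with positive probability.  OT may contain further values, and
   sys may be defined on further inputs; conditioning on O = o would be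
   inconsistent for the values o arising only there. *)
Definition outputs : set OT :=
  [set o | exists x a,
     0 < PrSE [set v | valX v = x /\ valA v = a] /\ sys SE x a = o].

Definition uninformative : Prop :=
  exists2 o, outputs o & Pr_given (out_is o) [::] = 1.

Definition can_trivially_close phi : Prop :=
  exists2 o, outputs o & open_for phi [::] /\ closed_for phi [:: out_is o].

End Closing.

(* Main.v *)
(* If phi is open for SE and s cannot trivially close it, then phi and its
   negation both have positive probability jointly with every output.  Given an
   output o, a second output o' exists since s is informative, by discreteness.
   Then phi /\ O = o and ~ phi /\ O = o' witness that phi is open for the
   implication O = o -> phi, whereas adding O = o forces phi. *)

Require Import Defs.
From mathcomp Require Import all_boot all_order all_algebra.
From mathcomp Require Import boolp classical_sets functions cardinality reals ereal.
From mathcomp Require Import measure probability.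
Set Implicit Arguments.
Unset Strict Implicit.
Unset Printing Implicit Defensive.
Import Order.TTheory GRing.Theory Num.Theory.
Local Open Scope classical_set_scope.
Local Open Scope ring_scope.

(** If every point of [B] were null, [B] would be covered by the null complement of the countable
    carrier [S] and by countably many null sets, one for each point of [S]. *)
Lemma discrete_atom d (W : measurableType d) (R : realType)
    (P : probability W R) (B : set W) :
  discrete P -> (0 < P B)%E -> exists2 w, B w & (0 < P [set w])%E.
Proof.
move=> [mP [S cS PS]] PB; apply: contrapT => noatom.
have null w : B w -> P [set w] = 0%E.
  move=> Bw; apply/eqP; rewrite eq_le measure_ge0 andbT leNgt.
  by apply/negP => ?; apply: noatom; exists w.
suff : P.-negligible B.
  by move=> /(negligibleP P (mP B)) PB0; rewrite PB0 ltxx in PB.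
have nullSC : P.-negligible (~` S).
  by apply/(negligibleP P (mP _)); rewrite [LHS](probability_setC P)// PS subee.
(* Either [S] is empty and its null complement is everything, or a surjection [f] from the naturals
   enumerates it. *)
have /pfcard_geP [S0|/unsquash f] := cS.
  by apply: negligibleS nullSC; rewrite S0 setC0; apply: subsetT.
have nullSB : P.-negligible (\bigcup_n (B `&` [set f n])).
  apply: negligible_bigcup => n; apply/(negligibleP P (mP _)); rewrite -[LHS]/(P _).
  (* Outside [B] the point [f n] may carry mass, hence the intersection with [B], which is then
     empty. *)
  have [Bfn|nBfn] := pselect (B (f n)).
    by rewrite setIC setIidl ?null// => _ ->.
  by rewrite (_ : B `&` _ = set0) ?measure0// -subset0 => w [+ wfn]; rewrite wfn.
apply: negligibleS (negligibleU nullSC nullSB) => w Bw.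
have [/(surj (f := f)) [n _ fn]|?] := pselect (S w); last by left.
by right; exists n.
Qed.

Section PrSE.
Context d (W : measurableType d) (R : realType) (P : probability W R).
Hypothesis dP : discrete P.
Variables (XT AT OT : Type) (SE : struct_eqs W XT AT OT).
Implicit Types (phi psi : condition W XT AT OT).
Implicit Types (C : seq (condition W XT AT OT)).

Lemma PrSE_ge0 phi : 0 <= PrSE P SE phi.
Proof. exact: fine_ge0. Qed.

Lemma PrSE_setT : PrSE P SE setT = 1.
Proof. by rewrite /PrSE preimage_setT probability_setT. Qed.

Lemma PrSE_setID phi psi :
  PrSE P SE psi = PrSE P SE (phi `&` psi) + PrSE P SE (~` phi `&` psi).
Proof.
have mP := dP.1; rewrite /PrSE -fineD ?fin_num_measure// -measureU//.
  by rewrite -preimage_setU -setIUl setUv setTI.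
by rewrite -preimage_setI setIACA setICr set0I preimage_set0.
Qed.

Lemma le_PrSE phi psi : phi `<=` psi -> PrSE P SE phi <= PrSE P SE psi.
Proof.
by move=> /setIidl sub; rewrite (PrSE_setID phi psi) sub lerDl PrSE_ge0.
Qed.

(** An atom [w] inside the event fixes an input pair, whose event contains [w] and so has positive
    probability; this is what membership in [outputs] asks for. *)
Lemma PrSE_atom psi :
  0 < PrSE P SE psi -> exists2 v, psi v & outputs P SE (valO v).
Proof.
move=> psi_gt0.
have : (0 < P (solution SE @^-1` psi))%E.
  rewrite lt0e measure_ge0 andbT; apply: contraTneq psi_gt0.
  by rewrite /PrSE => ->; rewrite ltxx.
move=> /(discrete_atom dP) [w psiw Pw].
exists (solution SE w) => //; exists (bgX SE w), (bgA SE w); split => //.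
have mP := dP.1.
rewrite /PrSE fine_gt0// ltey_eq fin_num_measure// andbT.
apply: (lt_le_trans Pw); apply: le_measure; rewrite ?inE//.
by move=> _ ->.
Qed.

Lemma outputs_gt0 o : outputs P SE o -> 0 < PrSE P SE (@out_is W XT AT OT o).
Proof.
move=> [x [a [xa_gt0 <-]]]; apply: (lt_le_trans xa_gt0); rewrite /PrSE.
have mP := dP.1; rewrite fine_le ?fin_num_measure//.
by apply: le_measure; rewrite ?inE// => w [/= <- <-].
Qed.

(** The two masses add up to the denominator of [Pr_given], so this form is free of division and
    already contains consistency. *)
Lemma open_forP phi C :
  open_for P SE phi C <->
  0 < PrSE P SE (phi `&` all_conds C) /\ 0 < PrSE P SE (~` phi `&` all_conds C).
Proof.
rewrite /open_for /consistent /Pr_given (PrSE_setID phi (all_conds C)).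
set x := PrSE _ _ _; set y := PrSE _ _ _.
have [x0 y0] : 0 <= x /\ 0 <= y by split; apply: PrSE_ge0.
split=> [[xy]|[xp yp]].
  by rewrite ltr_pdivlMr// mul0r ltr_pdivrMr// mul1r ltrDl => /andP.
have xy := addr_gt0 xp yp.
by rewrite xy ltr_pdivlMr// mul0r ltr_pdivrMr// mul1r ltrDl xp yp.
Qed.

(** Allows closedness to be proved by refuting openness. *)
Lemma closed_or_open phi C :
  consistent P SE C -> closed_for P SE phi C \/ open_for P SE phi C.
Proof.
move=> cC; rewrite open_forP /closed_for /Pr_given.
have := PrSE_setID phi (all_conds C); have := PrSE_ge0 (phi `&` all_conds C).
have := PrSE_ge0 (~` phi `&` all_conds C).
have cC0 : PrSE P SE (all_conds C) != 0 by rewrite gt_eqF.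
rewrite !le_eqVlt => /orP[/eqP <-|y_gt0] /orP[/eqP <-|x_gt0] E; last by right.
- by left; split=> //; left; rewrite mul0r.
- by left; split=> //; right; rewrite E addr0 divff // -(addr0 (PrSE _ _ _)) -E.
- by left; split=> //; left; rewrite mul0r.
Qed.

End PrSE.

Theorem theorem26 (R : realType) (d : measure_display) (W : measurableType d)
    (P : probability W R) (P_discrete : discrete P) (XT AT OT : Type)
    (X : W -> XT) (A : W -> AT) (s : XT -> AT -> OT)
    (phi : condition W XT AT OT) :
  let SE := StructEqs X A s in
  [\/ closed_for P SE phi [::],
      uninformative P SE,
      can_trivially_close P SE phi |
      forall o, outputs P SE o ->
        open_for P SE phi [:: out_isnt o `|` phi] /\
        closed_for P SE phi [:: out_is o; out_isnt o `|` phi]].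
Proof.
move=> SE.
have [cl|ncl] := pselect (closed_for P SE phi [::]); first by constructor 1.
have [un|inf] := pselect (uninformative P SE); first by constructor 2.
have [tr|ntr] := pselect (can_trivially_close P SE phi); first by constructor 3.
constructor 4 => o outo.
have cond1 psi : all_conds [:: psi] = psi :> condition W XT AT OT.
  by rewrite /all_conds big_seq1.
have cond2 psi chi :
    all_conds [:: psi; chi] = psi `&` chi :> condition W XT AT OT.
  by rewrite /all_conds big_cons big_seq1.
have op0 : open_for P SE phi [::].
  have [|//|//] := closed_or_open P_discrete (SE := SE) phi (C := [::]).
  by rewrite /consistent /all_conds big_nil PrSE_setT.
(* Since [phi] is open for [SE], being closed given [o'] would be a trivial closing. *)
have both o' : outputs P SE o' ->
    0 < PrSE P SE (phi `&` out_is o') /\ 0 < PrSE P SE (~` phi `&` out_is o').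
  move=> outo'; rewrite -[out_is _]cond1; apply/open_forP => //.
  have [||//] := closed_or_open P_discrete (SE := SE) phi (C := [:: out_is o']).
    by rewrite /consistent cond1 outputs_gt0.
  by move=> clo'; case: ntr; exists o'.
have [phio_gt0 _] := both o outo.
split.
  apply/open_forP => //; rewrite cond1; split.
    apply: (lt_le_trans phio_gt0); apply: le_PrSE => // v [phiv _].
    by split=> //; right.
  (* Otherwise the output is [o] with probability 1, against [inf]. *)
  have isnt_gt0 : 0 < PrSE P SE (out_isnt o).
    rewrite lt_neqAle PrSE_ge0 andbT; apply/eqP => isnt0.
    apply: inf; exists o => //.
    rewrite /Pr_given /all_conds big_nil PrSE_setT divr1 setIT.
    rewrite -(PrSE_setT P SE) (PrSE_setID P_discrete SE (out_is o) setT).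
    by rewrite !setIT -[PrSE P SE (~` _)]/(PrSE P SE (out_isnt o)) -isnt0 addr0.
  (* The second output is [valO v]; with it the disjunction holds through its left side, even where
     [phi] fails. *)
  have [v vo outv] := PrSE_atom P_discrete isnt_gt0.
  have [_ nphi_gt0] := both _ outv.
  apply: (lt_le_trans nphi_gt0); apply: le_PrSE => // u [nphiu uv].
  by split=> //; left; rewrite /out_isnt /= uv.
(* Openness is refuted: it would give positive mass to the failure of [phi] jointly with both
   conditions, an empty event. *)
have [|//|/open_forP] := closed_or_open P_discrete (SE := SE) phi
    (C := [:: out_is o; out_isnt o `|` phi]).
  rewrite /consistent cond2; apply: (lt_le_trans phio_gt0).
  by apply: le_PrSE => // v [phiv vo]; split=> //; right.
move=> /(_ P_discrete) [_]; rewrite cond2 (_ : _ `&` _ = set0).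
  by rewrite /PrSE preimage_set0 measure0 ltxx.
by rewrite -subset0 => v [nphiv [vo []]].
Qed.
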